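(* Let $d\in\mathbb{N}$. Every finitely generated ideal in $\mathcal{S}'(\mathbb{Z}^d)$ is principal, that is, $\mathcal{S}'(\mathbb{Z}^d)$ is a Bézout ring.
   Context: $\mathbb{N}=\{1,2,3,\dots\}$. For $\mathbf{n}=(n_1,\dots,n_d)\in\mathbb{Z}^d$ write $|\mathbf{n}|_1:=|n_1|+\cdots+|n_d|$. The set $\mathcal{S}'(\mathbb{Z}^d)$ consists of all maps $\mathbf{a}:\mathbb{Z}^d\to\mathbb{C}$ of at most polynomial growth, i.e. such that there exist a real $M>0$ and $k\in\mathbb{N}$ with $|\mathbf{a}(\mathbf{n})|\le M(1+|\mathbf{n}|_1)^k$ for all $\mathbf{n}\in\mathbb{Z}^d$. With pointwise addition and multiplication it is a commutative unital ring. A commutative ring is called Bézout if every finitely generated ideal is principal (the ring is not required to be a domain). *)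

(* Defs.v *)
From HB Require Import structures.
From mathcomp Require Import all_boot all_order all_algebra.
From mathcomp Require Import boolp classical_sets functions reals.
From mathcomp Require Import complex.

Set Implicit Arguments.
Unset Strict Implicit.
Unset Printing Implicit Defensive.

Import Order.TTheory GRing.Theory Num.Theory.
Local Open Scope classical_set_scope.
Local Open Scope ring_scope.
Local Open Scope complex_scope.

Definition norm1 (d : nat) (n : 'rV[int]_d) : nat := (\sum_(i < d) `|n ord0 i|)%N.

(* The product [M * ...] is computed in [R] and then embedded in [R[i]], where
   [`|z|] is also a (nonnegative real) element of [R[i]]. *)
Definition poly_growth (R : realType) (d : nat) (a : 'rV[int]_d -> R[i]) : Prop :=
  exists M : R, exists k : nat, [/\ 0 < M, (0 < k)%N &
    forall n : 'rV[int]_d, `|a n| <= (M * (1 + (norm1 n)%:R) ^+ k)%:C].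

Definition poly_growth_pred (R : realType) (d : nat) : {pred 'rV[int]_d -> R[i]} :=
  fun a => `[< poly_growth a >].

Section PolyGrowthSubring.
Variables (R : realType) (d : nat).
Implicit Types (a b : 'rV[int]_d -> R[i]).

Lemma poly_growth1 : poly_growth (1 : 'rV[int]_d -> R[i]).
Proof.
exists 1, 1%N; split=> // n.
by rewrite mul1r expr1 normr1 lecR lerDl ler0n.
Qed.

Lemma poly_growthB a b : poly_growth a -> poly_growth b -> poly_growth (a - b).
Proof.
move=> [M [k [M0 k0 aM]]] [N [l [N0 l0 bN]]].
exists (M + N), (k + l)%N; split; rewrite ?addr_gt0 ?addn_gt0 ?k0// => n.
have w1 : 1 <= 1 + (norm1 n)%:R :> R by rewrite lerDl ler0n.
apply: (le_trans (ler_normB (a n) (b n))).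
rewrite mulrDl rmorphD lerD//.
- apply: (le_trans (aM n)); rewrite lecR (ler_wpM2l (ltW M0))//.
  by rewrite ler_weXn2l// leq_addr.
- apply: (le_trans (bN n)); rewrite lecR (ler_wpM2l (ltW N0))//.
  by rewrite ler_weXn2l// leq_addl.
Qed.

Lemma poly_growthM a b : poly_growth a -> poly_growth b -> poly_growth (a * b).
Proof.
move=> [M [k [M0 k0 aM]]] [N [l [N0 l0 bN]]].
exists (M * N), (k + l)%N; split; rewrite ?mulr_gt0 ?addn_gt0 ?k0// => n.
by rewrite normrM exprD mulrACA rmorphM ler_pM.
Qed.

Fact poly_growth_subring_closed : subring_closed (@poly_growth_pred R d).
Proof.
split; first exact/asboolP/poly_growth1.
- by move=> a b /asboolP ga /asboolP gb; apply/asboolP/poly_growthB.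
- by move=> a b /asboolP ga /asboolP gb; apply/asboolP/poly_growthM.
Qed.

End PolyGrowthSubring.

(* S'(Z^d), with the ring structure inherited from the pointwise operations on
   functions; over a [realType] [R], the field [R[i]] is the complex numbers. *)
Record temperate (R : realType) (d : nat) := Temperate {
  temperate_fun :> 'rV[int]_d -> R[i];
  _ : temperate_fun \in @poly_growth_pred R d }.

Section TemperateRing.
Variables (R : realType) (d : nat).
HB.instance Definition _ := [isSub for @temperate_fun R d].
HB.instance Definition _ := [Choice of temperate R d by <:].
HB.instance Definition _ := GRing.SubChoice_isSubComPzRing.Build
  ('rV[int]_d -> R[i]) (@poly_growth_pred R d) (temperate R d)
  (@poly_growth_subring_closed R d).
End TemperateRing.

Section Bezout.
Variable A : comPzRingType.

(* The unit ideal is allowed, unlike in mathcomp's [proper_ideal]. *)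
Definition is_ideal (I : set A) : Prop :=
  [/\ I 0, forall x y, I x -> I y -> I (x + y) & forall c x, I x -> I (c * x)].

Definition ideal_generated (G : set A) : set A := smallest is_ideal G.

Definition finitely_generated_ideal (I : set A) : Prop :=
  exists s : seq A, I = ideal_generated [set` s].

Definition principal_ideal (I : set A) : Prop :=
  exists g : A, I = ideal_generated [set g].

End Bezout.

Definition bezout_ring (A : comPzRingType) : Prop :=
  forall I : set A, finitely_generated_ideal I -> principal_ideal I.

(* Main.v *)
(** Of two temperate families [a] and [b], let [g n] be whichever of [a n] and
    [b n] has the larger modulus. Then [g = u a + v b] with [u], [v] indicator
    functions, and [a], [b] are multiples of [g] because the quotients [a / g]
    and [b / g] have modulus at most 1. *)
Require Import Defs.
From mathcomp Require Import all_boot all_order all_algebra.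
From mathcomp Require Import reals.
From mathcomp Require Import boolp classical_sets functions complex.

Set Implicit Arguments.
Unset Strict Implicit.
Unset Printing Implicit Defensive.

Import Order.TTheory GRing.Theory Num.Theory.
Local Open Scope classical_set_scope.
Local Open Scope ring_scope.

Section IdealGenerated.
Variable A : comPzRingType.
Implicit Types (G I : set A) (a b g : A).

Lemma is_ideal_generated G : is_ideal (ideal_generated G).
Proof.
split=> [I [[I0 _ _] _] //|x y Gx Gy I IG|c x Gx I IG].
- by have [[_ ID _] _] := IG; apply: ID; [apply: Gx|apply: Gy].
- by have [[_ _ IM] _] := IG; apply: IM; apply: Gx.
Qed.

Lemma ideal_generated_min G I :
  is_ideal I -> G `<=` I -> ideal_generated G `<=` I.
Proof. by move=> idI GI x; apply; split. Qed.

Lemma sub_ideal_generated G : G `<=` ideal_generated G.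
Proof. by move=> x Gx I [_]; apply. Qed.

(** Induction on the list of generators: a gcd of the head and of a gcd of the tail, with Bézout
    coefficients, is one for the whole list. *)
Lemma bezout_ring_pairs :
  (forall a b, exists g, [/\ exists u v, g = u * a + v * b,
    exists p, a = p * g & exists q, b = q * g]) ->
  bezout_ring A.
Proof.
move=> pairs _ [s ->].
(* Membership of [g] gives one inclusion of ideals, divisibility of every generator by [g] the
   other. *)
suff [g gs sg] : exists2 g, ideal_generated [set` s] g &
    forall x, x \in s -> exists p, x = p * g.
  exists g; rewrite eqEsubset; split; apply: ideal_generated_min => //;
    try exact: is_ideal_generated.
  - move=> x /= /sg[p ->].
    have [_ _ idM] := is_ideal_generated [set g].
    by apply: idM; apply: sub_ideal_generated.
  - by move=> _ ->.
elim: s => [|a s [b bs sb]].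
  by exists 0 => //; have [] := is_ideal_generated [set` [::] : seq A].
have [g [[u [v gE]] [p aE] [q bE]]] := pairs a b; exists g.
- have [_ idD idM] := is_ideal_generated [set` a :: s].
  rewrite gE; apply: idD; apply: idM.
  + by apply: sub_ideal_generated => /=; rewrite mem_head.
  + apply: ideal_generated_min bs; first exact: is_ideal_generated.
    by move=> x /= xs; apply: sub_ideal_generated; rewrite /= inE xs orbT.
- move=> x; rewrite inE => /predU1P[->|/sb[r ->]]; first by exists p.
  by exists (r * q); rewrite -mulrA -bE.
Qed.

End IdealGenerated.

Section Temperate.
Variables (R : realType) (d : nat).
Implicit Types a b g : temperate R d.

Lemma temperate_bounded (c : 'rV[int]_d -> R[i]) :
  (forall n, `|c n| <= 1) -> exists t : temperate R d, t =1 c.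
Proof.
move=> c1; suff cP : c \in @poly_growth_pred R d by exists (Temperate cP).
apply/asboolP; have [M [k [M0 k0 M1]]] := @poly_growth1 R d.
exists M, k; split=> // n; apply: le_trans (c1 n) _.
by have := M1 n; rewrite normr1.
Qed.

(** The pointwise quotient is bounded by 1, hence temperate, even where [1 / g] grows too fast to
    be. *)
Lemma temperate_dvd_le a g :
  (forall n, `|a n| <= `|g n|) -> exists p, a = p * g.
Proof.
move=> ag; have [n|p pE] := @temperate_bounded (fun n => a n / g n).
  (* At zeros of [g] the convention [0^-1 = 0] makes the quotient 0. *)
  rewrite normrM normfV; have [->|g0] := eqVneq (g n) 0.
    by rewrite normr0 invr0 mulr0.
  by rewrite ler_pdivrMr ?normr_gt0// mul1r.
exists p; apply/val_inj/funext => n; rewrite rmorphM /=.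
transitivity (p n * g n) => //; rewrite pE.
(* Where [g] vanishes, the hypothesis forces [a] to vanish too. *)
have [g0|g0] := eqVneq (g n) 0; last by rewrite divfK.
by have := ag n; rewrite g0 normr0 normr_le0 mulr0 => /eqP.
Qed.

Lemma temperate_pair_gcd a b :
  exists g, [/\ exists u v, g = u * a + v * b,
    exists p, a = p * g & exists q, b = q * g].
Proof.
(* [u] selects the indices where [a] dominates, and [1 - u] the others. *)
have [n|u uE] := @temperate_bounded (fun n => (`|b n| <= `|a n|)%R%:R).
  by case: (`|b n| <= _); rewrite ?normr1 ?normr0 ?ler01.
have gE n : (u * a + (1 - u) * b) n = if `|b n| <= `|a n| then a n else b n.
  transitivity (u n * a n + (1 - u n) * b n) => //; rewrite uE.
  by case: ifP => _; rewrite ?subrr ?subr0 !mul0r !mul1r ?addr0 ?add0r.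
exists (u * a + (1 - u) * b); split; first by exists u, (1 - u).
- apply: temperate_dvd_le => n; rewrite gE.
  (* The order on [R[i]] is only partial; the two moduli are comparable because they are real. *)
  by case: (real_leP (normr_real (b n)) (normr_real (a n))) => // /ltW.
- by apply: temperate_dvd_le => n; rewrite gE; case: ifP.
Qed.

End Temperate.

Theorem theorem3p1 (R : realType) (d : nat) (hd : (0 < d)%N) :
  bezout_ring (temperate R d).
Proof. exact/bezout_ring_pairs/temperate_pair_gcd. Qed.
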